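(* Let $n\ge 1$, let $\mathcal{H}$ be a Hilbert space, let $\mathbf{Q}=(Q_1,\dots,Q_{n!})$ be a quantum measurement on $\mathcal{H}$, let $\Pi_1,\dots,\Pi_{n!}$ be the $n\times n$ permutation matrices, and let $\mathcal{B}=\sum_{l=1}^{n!}\Pi_l\otimes Q_l$. Then $\mathcal{B}$ is a doubly normalised tensor (DNT), and the set $\{\mathbf{R}^{(1)},\dots,\mathbf{R}^{(n)},\mathbf{C}^{(1)},\dots,\mathbf{C}^{(n)}\}$ of all row- and column-measurements of $\mathcal{B}$ is jointly measurable.
   Context: $\mathcal{L}(\mathcal{H})$ is the space of (bounded) linear operators on $\mathcal{H}$, $I$ is the identity operator, and $A\ge 0$ means $A$ is positive semi-definite. A quantum measurement (POVM) with $m$ outcomes on $\mathcal{H}$ is a tuple $(A_1,\dots,A_m)\in\mathcal{L}(\mathcal{H})^m$ with $A_i\ge 0$ and $\sum_i A_i=I$. An $n\times n$ doubly normalised tensor (DNT) is an array $\mathcal{A}=[A_{ij}]\in\mathcal{L}(\mathcal{H})^{n\times n}$ with every $A_{ij}\ge 0$, $\sum_j A_{ij}=I$ for every $i$, and $\sum_i A_{ij}=I$ for every $j$. It is identified with $\sum_{i,j}E_{ij}\otimes A_{ij}$, where $E_{ij}$ is the $n\times n$ matrix unit with 1 in position $(i,j)$ and 0 elsewhere. Its row-measurements are $\mathbf{R}^{(i)}=(A_{ij})_j$ and its column-measurements are $\mathbf{C}^{(j)}=(A_{ij})_i$. Writing also $\Pi_l$ for the permutation of $\{1,\dots,n\}$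 associated with the permutation matrix $\Pi_l$, $\Pi_l=\sum_i E_{\Pi_l(i),i}$. A finite family of $n$-outcome measurements $\mathbf{A}^{(1)},\dots,\mathbf{A}^{(m)}$ is jointly measurable if there are a measurement $\mathbf{M}=(M_k)_k$ with finitely many outcomes (a mother measurement) and real numbers $\mu(j|\mathbf{A}^{(i)},k)\ge 0$ (a post-processing map) with $\sum_j\mu(j|\mathbf{A}^{(i)},k)=1$ for all $i,k$, such that $A^{(i)}_j=\sum_k\mu(j|\mathbf{A}^{(i)},k)M_k$ for all $i,j$. *)

(* Defs.v *)
From HB Require Import structures.
From mathcomp Require Import all_boot all_order all_algebra perm.
From mathcomp Require Import complex.
From mathcomp Require Import boolp classical_sets functions reals topology.
From mathcomp Require Import normedtype.

Set Implicit Arguments.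
Unset Strict Implicit.
Unset Printing Implicit Defensive.

Import Order.TTheory GRing.Theory Num.Theory.
Import numFieldNormedType.Exports.

Local Open Scope ring_scope.
Local Open Scope complex_scope.

(* Complex Hilbert spaces, not necessarily separable or finite-dimensional.
   The inner product is linear in its first argument and conjugate-linear in
   the second one. *)
HB.mixin Record isHilbert (R : realType) H
    of CompleteNormedModule R[i] H := {
  inner : {dot H for (@Num.conj R[i])} ;
  inner_norm : forall x : H, `|x| ^+ 2 = inner x x
}.

#[short(type="hilbertType")]
HB.structure Definition Hilbert (R : realType) :=
  {H of CompleteNormedModule R[i] H & isHilbert R H}.

Definition bounded_linear (R : realType) (H : hilbertType R) : {pred H -> H} :=
  [pred f | `[< linear f /\
                exists M : R, forall x : H, `|f x| <= M%:C * `|x| >]].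

Record bounded_op (R : realType) (H : hilbertType R) := BoundedOp {
  bounded_op_fun :> H -> H ;
  bounded_opP : bounded_op_fun \in @bounded_linear R H
}.

Section BoundedOpTheory.
Context {R : realType} {H : hilbertType R}.

HB.instance Definition _ := [isSub for @bounded_op_fun R H].
HB.instance Definition _ := [Choice of bounded_op H by <:].

Lemma bounded_linear_submod : submod_closed (@bounded_linear R H).
Proof.
split=> [|a f g]; rewrite !unfold_in /=.
  apply/asboolP; split; first by move=> a x y; rewrite scaler0 addr0.
  by exists 0 => x; rewrite normr0 mul0r.
move=> /asboolP[lf [Mf bf]] /asboolP[lg [Mg bg]]; apply/asboolP; split.
  move=> b x y; rewrite !fctE /= lf lg !scalerDr !scalerA (mulrC b a).
  by rewrite addrACA.
exists (ComplexField.Normc.normc a * Mf + Mg) => x; rewrite !fctE.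
rewrite (le_trans (ler_normD _ _))// normrZ rmorphD rmorphM mulrDl -mulrA.
by apply: lerD => //; apply: ler_wpM2l.
Qed.

HB.instance Definition _ :=
  GRing.isSubmodClosed.Build R[i] (H -> H) (@bounded_linear R H)
    bounded_linear_submod.
HB.instance Definition _ := [SubChoice_isSubLmodule of bounded_op H by <:].

Lemma bounded_linear_id : (@idfun H) \in @bounded_linear R H.
Proof.
by rewrite unfold_in /=; apply/asboolP; split=> //; exists 1 => x; rewrite mul1r.
Qed.

Definition bounded_op_id : bounded_op H := BoundedOp bounded_linear_id.

End BoundedOpTheory.

Arguments bounded_op_id {R} H.

(* [0 <= z] in R[i] means that z is real and nonnegative, so that (as H is
   complex) this condition contains the self-adjointness of A. *)
Definition psd (R : realType) (H : hilbertType R) (A : bounded_op H) : Prop :=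
  forall x : H, 0 <= inner (A x) x.

Definition measurement (R : realType) (H : hilbertType R) (m : nat)
    (A : 'I_m -> bounded_op H) : Prop :=
  (forall i, psd (A i)) /\ \sum_i A i = bounded_op_id H.

(* The element of M_n(C) (x) L(H) with operator-valued coordinates A_ij on the
   matrix units E_ij is represented by its array of coordinates, as a matrix
   over L(H). *)
Definition dnt (R : realType) (H : hilbertType R) (n : nat)
    (A : 'M[bounded_op H]_n) : Prop :=
  [/\ forall i j, psd (A i j),
      forall i, \sum_j A i j = bounded_op_id H &
      forall j, \sum_i A i j = bounded_op_id H].

Definition op_tensor (R : realType) (H : hilbertType R) (n : nat)
    (M : 'M[R[i]]_n) (A : bounded_op H) : 'M[bounded_op H]_n :=
  \matrix_(i, j) (M i j *: A).

(* This is the transpose of mathcomp's [perm_mx s]. *)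
Definition permutation_matrix (R : realType) (n : nat) (s : 'S_n) :
    'M[R[i]]_n :=
  \sum_i delta_mx (s i) i.

Definition row_measurement (R : realType) (H : hilbertType R) (n : nat)
    (A : 'M[bounded_op H]_n) (i : 'I_n) : 'I_n -> bounded_op H :=
  fun j => A i j.

Definition column_measurement (R : realType) (H : hilbertType R) (n : nat)
    (A : 'M[bounded_op H]_n) (j : 'I_n) : 'I_n -> bounded_op H :=
  fun i => A i j.

(* The family is indexed by an arbitrary finite type T; [mu t k j] stands for
   mu(j | A^(t), k). *)
Definition jointly_measurable (R : realType) (H : hilbertType R)
    (T : finType) (n : nat) (A : T -> 'I_n -> bounded_op H) : Prop :=
  (forall t, measurement (A t)) /\
  exists (p : nat) (M : 'I_p -> bounded_op H) (mu : T -> 'I_p -> 'I_n -> R),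
    [/\ measurement M,
        forall t k j, 0 <= mu t k j,
        forall t k, \sum_j mu t k j = 1 &
        forall t j, A t j = \sum_k (mu t k j)%:C *: M k].

Definition row_column_measurements (R : realType) (H : hilbertType R)
    (n : nat) (A : 'M[bounded_op H]_n) (t : 'I_n + 'I_n) :
    'I_n -> bounded_op H :=
  match t with
  | inl i => row_measurement A i
  | inr j => column_measurement A j
  end.

(* Main.v *)
(* Each row i and each column j of B is obtained from Q by a deterministic
   relabelling of outcomes, l |-> Pi_l^-1(i) and l |-> Pi_l(j) respectively, so
   Q itself is a mother measurement for the whole family. *)
Require Import Defs.
From mathcomp Require Import all_boot all_order all_algebra perm.
From mathcomp Require Import complex.
From mathcomp Require Import boolp classical_sets functions reals topology.
From mathcomp Require Import normedtype.
From mathcomp Require Import sesquilinear.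

Set Implicit Arguments.
Unset Strict Implicit.
Unset Printing Implicit Defensive.

Import Order.TTheory GRing.Theory Num.Theory.
Import numFieldNormedType.Exports.

Local Open Scope ring_scope.

Lemma psd0 (R : realType) (H : hilbertType R) : psd (0 : bounded_op H).
Proof. by move=> x; have -> : (0 : bounded_op H) x = 0 by []; rewrite linear0l lexx. Qed.

Lemma psdD (R : realType) (H : hilbertType R) (A B : bounded_op H) :
  psd A -> psd B -> psd (A + B).
Proof.
move=> psdA psdB x; have -> : (A + B) x = A x + B x by [].
by rewrite linearDl; apply: addr_ge0; [exact: psdA | exact: psdB].
Qed.

(** The fibres of [f] partition the outcomes of [M], so merging each fibre only regroups the sum to
    the identity, and positivity survives finite sums. *)
Lemma measurement_relabel (R : realType) (H : hilbertType R) (p n : nat)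
    (M : 'I_p -> bounded_op H) (f : 'I_p -> 'I_n) :
  measurement M -> measurement (fun j => \sum_(k | f k == j) M k).
Proof.
move=> [psdM sumM]; split=> [j|].
  by apply: big_ind => // [|A B]; [exact: psd0 | exact: psdD].
by rewrite -sumM [RHS](partition_big f predT).
Qed.

Lemma jointly_measurable_relabel (R : realType) (H : hilbertType R)
    (T : finType) (p n : nat) (M : 'I_p -> bounded_op H)
    (f : T -> 'I_p -> 'I_n) (A : T -> 'I_n -> bounded_op H) :
  measurement M -> (forall t j, A t j = \sum_(k | f t k == j) M k) ->
  jointly_measurable A.
Proof.
move=> measM AE; split=> [t|].
  have -> : A t = fun j => \sum_(k | f t k == j) M k by apply/funext/AE.
  exact: measurement_relabel.
(* The post-processing is deterministic: given outcome [k], it is the point mass at [f t k]. *)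
exists p, M, (fun t k j => (f t k == j)%:R); split=> // [t k|t j].
  by rewrite (bigD1 (f t k)) //= eqxx big1 ?addr0 // => j;
    rewrite eq_sym => /negbTE ->.
rewrite AE big_mkcond; apply: eq_bigr => k _.
by case: eqP => _; rewrite rmorph_nat ?scale1r ?scale0r.
Qed.

Lemma permutation_matrixE (R : realType) (n : nat) (s : 'S_n) (i j : 'I_n) :
  permutation_matrix R s i j = (s j == i)%:R.
Proof.
rewrite summxE (bigD1 j) //= mxE eqxx andbT big1 ?addr0 1?eq_sym //.
by move=> k /negbTE kj; rewrite mxE (eq_sym j) kj andbF.
Qed.

(** The 0/1 entries of the permutation matrices select which effects contribute. With [j] fixed the
    condition is already a relabelling of [l]; with [i] fixed it becomes one after inverting
    [s l]. *)
Lemma sum_op_tensor_permE (R : realType) (H : hilbertType R) (p n : nat)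
    (Q : 'I_p -> bounded_op H) (s : 'I_p -> 'S_n) (i j : 'I_n) :
  (\sum_l op_tensor (permutation_matrix R (s l)) (Q l)) i j
  = \sum_(l | s l j == i) Q l.
Proof.
rewrite summxE [RHS]big_mkcond; apply: eq_bigr => l _.
by rewrite mxE permutation_matrixE; case: eqP => _; rewrite ?scale1r ?scale0r.
Qed.

Theorem proposition2 (R : realType) (H : hilbertType R) (n : nat)
    (n_ge1 : (1 <= n)%N)
    (Q : 'I_(n`!) -> bounded_op H) (measQ : measurement Q)
    (Pi : 'I_(n`!) -> 'S_n) (bijPi : bijective Pi) :
  let B : 'M[bounded_op H]_n :=
    \sum_(l < n`!) op_tensor (permutation_matrix R (Pi l)) (Q l) in
  dnt B /\ jointly_measurable (row_column_measurements B).
Proof.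
move=> B.
(* Joint measurability comes first because it includes that every row and column is a measurement,
   which yields the DNT conditions. *)
have jmB : jointly_measurable (row_column_measurements B).
  pose f (t : 'I_n + 'I_n) l :=
    match t with inl i => (Pi l)^-1%g i | inr j => Pi l j end.
  apply: (jointly_measurable_relabel (f := f) measQ).
  move=> [i|j] k /=; rewrite /row_measurement /column_measurement
    sum_op_tensor_permE //.
  (* Only the rows remain: applying the injective [Pi l] to both sides of [(Pi l)^-1 i == k] gives
     [i == Pi l k]. *)
  by apply: eq_bigl => l; rewrite eq_sym -(inj_eq (@perm_inj _ (Pi l)) _ k) permKV.
(* Positivity and the row sums are read off the rows, the column sums off the columns. *)
split=> //; case: jmB => measB _; split=> [i j|i|j].
- exact: (measB (inl i)).1.
- exact: (measB (inl i)).2.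
- exact: (measB (inr j)).2.
Qed.
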